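(* Let $\alpha\in(0,1)$, let $(X_t)_{t\in\mathbb{N}_0}$ be the symmetric Antlion Random Walk with parameter $\alpha$ started at $X_0=0$, and for $t\in\mathbb{N}$ let $$A_t^{(\alpha)}=\sqrt{\frac{1-\alpha^2}{1-\alpha^{2t}}}\,X_t .$$ Let $Z$ be a random variable following the standard normal distribution. Then $A_t^{(\alpha)}$ does not converge weakly (in distribution) to $Z$ as $t\to\infty$.
   Context: $\mathbb{N}=\{1,2,3,\dots\}$ and $\mathbb{N}_0=\mathbb{N}\cup\{0\}$. Let $(\xi_t)_{t\in\mathbb{N}}$ be independent, identically distributed random variables with $\mathbb{P}(\xi_t=-1)=\mathbb{P}(\xi_t=1)=\tfrac12$. The symmetric Antlion Random Walk (ARW) with parameter $\alpha$ is the real-valued process defined by $X_0=0$ and $X_t=\alpha X_{t-1}+\xi_t$ for $t\in\mathbb{N}$; equivalently $X_t=\sum_{s=1}^{t}\alpha^{t-s}\xi_s$. *)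

(* Defs.v *)
From HB Require Import structures.
From mathcomp Require Import all_boot all_order all_algebra finmap.
From mathcomp Require Import all_classical all_reals all_analysis.
From mathcomp Require Import measurable_realfun.

Set Implicit Arguments.
Unset Strict Implicit.
Unset Printing Implicit Defensive.

Import Order.TTheory GRing.Theory Num.Theory.
Import numFieldNormedType.Exports.

Local Open Scope classical_set_scope.
Local Open Scope ring_scope.

(* Mutual independence of the family [X i], [i] in [D]: the product rule holds
   for every finite subfamily. *)
Definition independent_RVs {R : realType} {d : measure_display}
    {T : measurableType d} (P : probability T R) {I : choiceType} (D : set I)
    (X : I -> {RV P >-> R}) : Prop :=
  forall (J : {fset I}) (B : I -> set R),
    [set` J] `<=` D -> (forall i, i \in J -> measurable (B i)) ->
    P (\bigcap_(i in [set` J]) (X i @^-1` B i)) =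
    (\prod_(i <- J) P (X i @^-1` B i))%E.
Arguments independent_RVs {R d T} P {I} D X.

(* Laws are compared on Borel sets only: the value of a measure on a
   non-measurable set carries no information. *)
Definition identically_distributed {R : realType} {d : measure_display}
    {T : measurableType d} (P : probability T R) {I : choiceType} (D : set I)
    (X : I -> {RV P >-> R}) : Prop :=
  forall i j, D i -> D j -> forall B : set R, measurable B ->
    distribution P (X i) B = distribution P (X j) B.
Arguments identically_distributed {R d T} P {I} D X.

Definition iid {R : realType} {d : measure_display}
    {T : measurableType d} (P : probability T R) {I : choiceType} (D : set I)
    (X : I -> {RV P >-> R}) : Prop :=
  independent_RVs P D X /\ identically_distributed P D X.
Arguments iid {R d T} P {I} D X.

Definition rademacher {R : realType} {d : measure_display}
    {T : measurableType d} (P : probability T R) (X : {RV P >-> R}) : Prop :=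
  P [set w | X w = -1] = (2^-1)%:E /\ P [set w | X w = 1] = (2^-1)%:E.
Arguments rademacher {R d T} P X.

Definition standard_normal {R : realType} {d : measure_display}
    {T : measurableType d} (P : probability T R) (Z : {RV P >-> R}) : Prop :=
  forall B : set R, measurable B -> distribution P Z B = normal_prob 0 1 B.
Arguments standard_normal {R d T} P Z.

(* The sample space of the limit need not be that of the sequence. *)
Definition converges_weakly {R : realType} {d d' : measure_display}
    {T : measurableType d} {T' : measurableType d'}
    (P : probability T R) (P' : probability T' R)
    (X : nat -> {RV P >-> R}) (Z : {RV P' >-> R}) : Prop :=
  forall f : R -> R, continuous f -> bounded_fun f ->
    ('E_P[f \o X n] @[n --> \oo] --> 'E_P'[f \o Z])%E.
Arguments converges_weakly {R d d' T T'} P P' X Z.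

(* [xi 0] plays no role: the steps are [xi 1], [xi 2], etc. *)
Fixpoint arw {R : realType} {d : measure_display}
    {T : measurableType d}
    (alpha : R) (xi : nat -> {mfun T >-> R}) (t : nat) : T -> R :=
  if t is s.+1 then fun w => alpha * arw alpha xi s w + xi s.+1 w
  else fun=> 0.

Definition normalized_arw {R : realType} {d : measure_display}
    {T : measurableType d}
    (alpha : R) (xi : nat -> {mfun T >-> R}) (t : nat) : T -> R :=
  fun w => Num.sqrt ((1 - alpha ^+ 2) / (1 - alpha ^+ (2 * t))) *
           arw alpha xi t w.

Section arw_measurable.
Context {R : realType} {d : measure_display} {T : measurableType d}
  (alpha : R) (xi : nat -> {mfun T >-> R}) (t : nat).

Let measurable_arw : measurable_fun [set: T] (arw alpha xi t).
Proof.
elim: t => [|s IHs] /=; first exact: measurable_cst.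
by apply: measurable_funD => //; apply: measurable_funM.
Qed.

HB.instance Definition _ :=
  isMeasurableFun.Build _ _ _ _ (arw alpha xi t) measurable_arw.

Let measurable_normalized_arw :
  measurable_fun [set: T] (normalized_arw alpha xi t).
Proof. exact: measurable_funM. Qed.

HB.instance Definition _ := isMeasurableFun.Build _ _ _ _
  (normalized_arw alpha xi t) measurable_normalized_arw.

End arw_measurable.

(* Main.v *)
(** Almost surely every step has absolute value 1, hence
    [`|X_t| <= 1 + alpha + alpha^2 + ... <= K] with [K = 1 / (1 - alpha)], and
    the normalizing factor is at most 1.  A bounded continuous function that
    vanishes exactly on [[-K, K]] therefore has expectation 0 along the whole
    sequence, but positive expectation under the normal law, whose density
    vanishes nowhere. *)

Require Import Defs.
From mathcomp Require Import all_boot all_order all_algebra.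
From mathcomp Require Import all_classical all_reals all_analysis.
From mathcomp Require Import measurable_realfun ring lra.

Import Order.TTheory GRing.Theory Num.Theory.
Import numFieldNormedType.Exports.

Local Open Scope classical_set_scope.
Local Open Scope ring_scope.

(** A nonnegative density with zero integral over [A] vanishes almost everywhere on [A]. The normal
    density is positive at every point, so the exceptional null set must contain all of [A]. *)
Lemma lebesgue_normal_prob_eq0 (R : realType) (m s : R) : s != 0 ->
  forall A : set R, measurable A -> normal_prob m s A = 0%E ->
  lebesgue_measure A = 0%E.
Proof.
move=> s0 A mA; rewrite /normal_prob => A0.
apply: (@measure_negligible _ _ _ lebesgue_measure _ mA).
have mf : measurable_fun A (fun x => (normal_pdf m s x)%:E).
  apply/measurable_EFinP; apply: measurable_funS (measurable_normal_pdf m s) => //.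
have : (\int[lebesgue_measure]_(x in A)
    `|(normal_pdf m s x)%:E| = 0)%E.
  rewrite -[RHS]A0; apply: eq_integral => x _.
  by rewrite gee0_abs// lee_fin normal_pdf_ge0.
move=> /(ae_eq_integral_abs lebesgue_measure mA mf).
apply: negligibleS => x Ax /= /(_ Ax) [].
by apply/eqP; rewrite normal_pdfE// gt_eqF// mulr_gt0 ?expR_gt0 ?normal_peak_gt0.
Qed.

Lemma rademacher_ae_norm {R : realType} {d : measure_display}
    {T : measurableType d} (P : probability T R) (X : {RV P >-> R}) :
  rademacher P X -> {ae P, forall w, `|X w| = 1}.
Proof.
move=> [PN P1].
have mX (c : R) : measurable (X @^-1` [set c]) by exact: measurable_funPTI.
(* The two atoms are disjoint and already carry the full mass, so the complement of their union is a
   null set. *)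
have PU : P (X @^-1` [set -1] `|` X @^-1` [set 1]) = 1%E.
  rewrite measureU//; last first.
    by clear; apply/seteqP; split=> // w /= [->] ?; lra.
  transitivity ((2^-1)%:E + (2^-1)%:E : \bar R)%E; first exact: f_equal2.
  by clear; rewrite -EFinD; congr EFin; lra.
exists (~` (X @^-1` [set -1] `|` X @^-1` [set 1])); split.
- by apply: measurableC; exact: measurableU.
- by rewrite [LHS]probability_setC ?PU ?subee//; exact: measurableU.
- by apply: subsetC => w /= [] ->; rewrite ?normrN normr1.
Qed.

Lemma arw_ae_bounded {R : realType} {d : measure_display}
    {T : measurableType d} (P : probability T R) (xi : nat -> {RV P >-> R})
    (alpha : R) : 0 < alpha -> alpha < 1 ->
  (forall t : nat, (0 < t)%N -> rademacher P (xi t)) ->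
  forall t, {ae P, forall w, `|arw alpha xi t w| <= (1 - alpha)^-1}.
Proof.
move=> a0 a1 xiP; elim=> [|t IHt].
  by apply: aeW => w /=; rewrite normr0 invr_ge0 subr_ge0 ltW.
have := rademacher_ae_norm _ _ (xiP t.+1 isT).
apply: filterS2 IHt => w /= arw_le xi1.
(* The bound is the fixed point of [x |-> alpha * x + 1], so one more step of size 1 preserves
   it. *)
have -> : (1 - alpha)^-1 = alpha * (1 - alpha)^-1 + 1.
  by field; rewrite subr_eq0 gt_eqF.
rewrite (le_trans (ler_normD _ _))// xi1 normrM gtr0_norm//.
by rewrite lerD2r ler_pM2l.
Qed.

Lemma normalized_arw_le {R : realType} {d : measure_display}
    {T : measurableType d} (alpha : R) (xi : nat -> {mfun T >-> R}) t w :
  0 < alpha -> alpha < 1 ->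
  `|normalized_arw alpha xi t w| <= `|arw alpha xi t w|.
Proof.
(* At time 0 the denominator [1 - alpha ^+ 0] is zero, but the walk itself is 0 there. At later
   times [alpha ^+ (2 * t.+1) <= alpha ^+ 2] makes the ratio at most 1. *)
move=> a0 a1; case: t => [|t]; first by rewrite /normalized_arw /= mulr0.
rewrite normrM ler_piMl// ger0_norm ?sqrtr_ge0//.
rewrite -[leRHS]sqrtr1 ler_wsqrtr// ler_pdivrMr ?mul1r.
  by rewrite lerD2l lerN2 ler_wiXn2l ?ltW// mulnS.
by rewrite subr_gt0 exprn_ilt1// ltW.
Qed.

(** For [K >= 0] this is the distance from [x] to the interval [[-K, K]], capped at 1 to keep it
    bounded. *)
Definition tail_test {R : realType} (K x : R) : R :=
  Num.min 1 (Num.max 0 (`|x| - K)).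

Lemma continuous_tail_test {R : realType} (K : R) : continuous (tail_test K).
Proof.
apply: (@min_fun_continuous _ _ R (cst 1)); first exact: cst_continuous.
apply: (@max_fun_continuous _ _ R (cst 0)); first exact: cst_continuous.
by move=> x; apply: cvgB; [exact: norm_continuous|exact: cvg_cst].
Qed.

Lemma tail_test_ge0 {R : realType} (K x : R) : 0 <= tail_test K x.
Proof. by rewrite /tail_test le_min ler01 le_max lexx. Qed.

Lemma bounded_tail_test {R : realType} (K : R) : bounded_fun (tail_test K).
Proof.
exists 1; split; first exact: num_real.
move=> M M1 x _ /=; rewrite ger0_norm ?tail_test_ge0//.
by rewrite (le_trans _ (ltW M1))// /tail_test ge_min lexx.
Qed.

Lemma tail_test_eq0 {R : realType} (K x : R) :
  (tail_test K x == 0) = (`|x| <= K).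
Proof.
rewrite -[RHS]subr_le0 /tail_test; have [h|h] := leP (`|x| - K) 0.
  by rewrite min_r ?eqxx.
by rewrite gt_eqF// lt_min ltr01.
Qed.

Theorem theorem3p7 (R : realType)
  (d : measure_display) (T : measurableType d) (P : probability T R)
  (d' : measure_display) (T' : measurableType d') (P' : probability T' R)
  (xi : nat -> {RV P >-> R}) (Z : {RV P' >-> R}) (alpha : R)
  (alpha_gt0 : 0 < alpha) (alpha_lt1 : alpha < 1)
  (xi_iid : iid P [set t : nat | (0 < t)%N] xi)
  (xi_law : forall t : nat, (0 < t)%N -> rademacher P (xi t))
  (Z_law : standard_normal P' Z) :
  ~ converges_weakly P P' (fun t => normalized_arw alpha xi t) Z.
Proof.
set K := (1 - alpha)^-1 => weak.
have mf := continuous_measurable_fun (continuous_tail_test K).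
have Ef_arw t : ('E_P[tail_test K \o normalized_arw alpha xi t] = 0)%E.
  rewrite unlock -(integral0 P setT); apply: ae_eq_integral => //.
    by apply/measurable_EFinP; apply: measurableT_comp.
  have := arw_ae_bounded P xi alpha alpha_gt0 alpha_lt1 xi_law t.
  apply: filterS => w X_le _.
  congr EFin; apply/eqP; rewrite tail_test_eq0.
  by rewrite (le_trans _ X_le)// normalized_arw_le.
have Ef_Z : ('E_P'[tail_test K \o Z] = 0)%E.
  have := weak _ (continuous_tail_test K) (bounded_tail_test K).
  (* The expectations along the walk form the constant sequence 0, so uniqueness of limits gives the
     value at [Z]. *)
  under eq_fun do rewrite Ef_arw.
  by move=> /cvg_lim <-//; rewrite lim_cst.
(* The contradiction: this ray has infinite Lebesgue measure, yet it will be shown null for the law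
   of [Z]. *)
suff : @lebesgue_measure R `]K, +oo[%classic = 0%E.
  by rewrite lebesgue_measure_itv /= ltry.
apply: (lebesgue_normal_prob_eq0 _ 0 _ (oner_neq0 R)) => //.
rewrite -Z_law// /distribution /pushforward.
apply: measure_negligible.
  exact: measurable_funPTI.
(* Being nonnegative with zero expectation, [tail_test K \o Z] vanishes almost surely, whereas it is
   nonzero wherever [Z] exceeds [K]. *)
have : ae_eq P' setT (EFin \o (tail_test K \o Z)) (cst 0%E).
  apply/ae_eq_integral_abs => //.
    by apply/measurable_EFinP; apply: measurableT_comp.
  rewrite -[RHS]Ef_Z unlock; apply: eq_integral => w _.
  by rewrite gee0_abs// lee_fin tail_test_ge0.
apply: negligibleS => w /=; rewrite in_itv/= andbT => KZ /(_ I) [/eqP].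
by rewrite tail_test_eq0 leNgt (lt_le_trans KZ) ?ler_norm.
Qed.
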